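(* Let $f:\operatorname{dom} f\subseteq\mathbb{R}^n\to\mathbb{R}$ be $\mathcal{C}^4$ on an open domain containing $B(x^0;\Delta_S)$, where $x^0\in\operatorname{dom} f$ is the point of interest and $\Delta_S=\max_{i\in\{1,\dots,k\}}\Vert s^i\Vert>0$ is the radius of $S=\begin{bmatrix}s^1&\cdots&s^k\end{bmatrix}\in\mathbb{R}^{n\times k}$. Let $W=S\odot S\in\mathbb{R}^{n\times k}$. Denote by $L_{\nabla^3 f}\ge 0$ the Lipschitz constant of $\nabla^3 f$ on $B(x^0;\Delta_S)$. If $W$ has full row rank, then $$\left\Vert \operatorname{diag}\left[\nabla^2_c f(x^0;S)\right]-\operatorname{diag}\left[\nabla^2 f(x^0)\right]\right\Vert\le \left\Vert(\widetilde{W}^\top)^\dagger\right\Vert\left(\frac{k}{12}L_{\nabla^3 f}\,\Delta_S^2+2\sum_{i=1}^k\left\vert(\hat{s}^i)^\top U[\nabla^2 f(x^0)]\,\hat{s}^i\right\vert\right),$$ where $\widetilde{W}=W/\Delta_S^2$ and $\hat{s}^i=s^i/\Delta_S$ for all $i\in\{1,2,\dots,k\}$.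
   Context: Vector norms are Euclidean ($\ell_2$) and matrix norms are the induced $\ell_2$ operator norms. $B(x^0;\Delta)$ is the closed ball of radius $\Delta$ centered at $x^0$. The third derivative $\nabla^3 f(x)$ is regarded as a symmetric trilinear form on $\mathbb{R}^n$, and Lipschitz continuity of $\nabla^3 f$ is with respect to the norm on trilinear forms induced by the Euclidean norm. $A\odot B$ is the Hadamard (entrywise) product of matrices of the same size. $A^\dagger$ is the Moore--Penrose pseudoinverse of $A$. For a square matrix $M\in\mathbb{R}^{n\times n}$, $\operatorname{diag}[M]\in\mathbb{R}^n$ is the vector of its diagonal entries, and $U[M]\in\mathbb{R}^{n\times n}$ is its strictly upper triangular part (entries strictly above the diagonal kept, all others set to $0$). Centered simplex Hessian diagonal (CSHD): for $f$, $x^0\in\operatorname{dom} f$, and $S=\begin{bmatrix}s^1&\cdots&s^k\end{bmatrix}\in\mathbb{R}^{n\times k}$ with $x^0\pm s^i\in\operatorname{dom} f$ for all $i$, let $W=S\odot S=\begin{bmatrix}s^1\odot s^1&\cdots&s^k\odot s^k\end{bmatrix}$ and let $\varepsilon_f(x^0;S)\in\mathbb{R}^k$ be the vector with $i$-th entry $f(x^0+s^i)+f(x^0-s^i)-2f(x^0)$. The CSHD of $f$ at $x^0$ over $S$ is the vector in $\mathbb{R}^n$ $$\operatorname{diag}\left[\nabla^2_c f(x^0;S)\right]=(W^\top)^\dagger\,\varepsilon_f(x^0;S).$$ *)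

(* Defs.v *)
From HB Require Import structures.
From mathcomp Require Import all_boot all_order all_algebra.
From mathcomp Require Import all_classical all_reals all_analysis.
Set Implicit Arguments.
Unset Strict Implicit.
Unset Printing Implicit Defensive.
Import Order.TTheory GRing.Theory Num.Theory.
Import numFieldNormedType.Exports.
Local Open Scope classical_set_scope.
Local Open Scope ring_scope.

(* Points of R^n are column vectors. The library norm `|_| on matrices is the *)
(* sup norm; it is used here only through the topology it induces (openness,  *)
(* continuity, differentiability), which is also the Euclidean one. All       *)
(* quantitative norms are the Euclidean ones below.                           *)
Section EuclideanNorms.
Variable R : realType.

Definition enorm n (x : 'cV[R]_n) : R := Num.sqrt (\sum_i x i 0 ^+ 2).

Definition eball n (x0 : 'cV[R]_n) (r : R) : set 'cV[R]_n :=
  [set x | enorm (x - x0) <= r].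

Definition opnorm m n (A : 'M[R]_(m, n)) : R :=
  sup [set enorm (A *m x) | x in [set x : 'cV[R]_n | enorm x <= 1]].

(* T is meant to be trilinear, hence bounded on the unit ball, so that this   *)
(* supremum is a genuine one ([sup] of an unbounded set is 0).                *)
Definition trinorm n (T : 'cV[R]_n -> 'cV[R]_n -> 'cV[R]_n -> R) : R :=
  sup [set r | exists u v w : 'cV[R]_n,
         [/\ enorm u <= 1, enorm v <= 1, enorm w <= 1 & r = `|T u v w|]].

End EuclideanNorms.

Section MatrixOperations.
Variable R : realType.

Definition hadamard m n (A B : 'M[R]_(m, n)) : 'M[R]_(m, n) :=
  \matrix_(i, j) (A i j * B i j).

Definition diagv n (M : 'M[R]_n) : 'cV[R]_n := \col_i M i i.

Definition supper n (M : 'M[R]_n) : 'M[R]_n :=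
  \matrix_(i, j) (if (i < j)%N then M i j else 0).

(* The four Penrose conditions, over the reals. *)
Definition is_mpinv m n (A : 'M[R]_(m, n)) (X : 'M[R]_(n, m)) : Prop :=
  [/\ A *m X *m A = A, X *m A *m X = X,
      (A *m X)^T = A *m X & (X *m A)^T = X *m A].

Definition mpinv m n (A : 'M[R]_(m, n)) : 'M[R]_(n, m) :=
  xget 0 [set X | is_mpinv A X].

Lemma is_mpinv_uniq m n (A : 'M[R]_(m, n)) X Y :
  is_mpinv A X -> is_mpinv A Y -> X = Y.
Proof.
move=> [x1 x2 x3 x4] [y1 y2 y3 y4].
have AXY : A *m X = A *m Y.
  by rewrite -[in LHS]y1 -mulmxA -[LHS]trmxK trmx_mul x3 y3 mulmxA x1 y3.
have XYA : X *m A = Y *m A.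
  rewrite -[in LHS]y1 -[LHS]trmxK (_ : X *m (A *m Y *m A) = X *m A *m (Y *m A)).
    by rewrite trmx_mul x4 y4 -mulmxA (mulmxA A) x1 y4.
  by rewrite !mulmxA.
by rewrite -x2 XYA -mulmxA AXY mulmxA y2.
Qed.

Lemma row_free_gram m n (B : 'M[R]_(m, n)) :
  row_free B -> B *m B^T \in unitmx.
Proof.
move=> fB; rewrite -row_free_unit -kermx_eq0; apply/eqP/row_matrixP => i.
rewrite row0; set v := row i _.
have : v *m (B *m B^T) = 0 by rewrite /v -row_mul mulmx_ker row0.
move=> /(congr1 (fun z => (z *m v^T) 0 0)).
rewrite mul0mx !mulmxA -mulmxA -trmx_mul mxE [RHS]mxE => /eqP.
rewrite psumr_eq0 => [/allP h|j _]; last by rewrite [_^T _ _]mxE sqr_ge0.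
have vB : v *m B = 0.
  apply/rowP => j; have := h j; rewrite mem_index_enum => /(_ isT) /=.
  by rewrite [_^T _ _]mxE -expr2 sqrf_eq0 => /eqP ->; rewrite mxE.
by apply: (row_free_inj fB); rewrite vB mul0mx.
Qed.

Lemma mpinvP m n (A : 'M[R]_(m, n)) : is_mpinv A (mpinv A).
Proof.
suff [X hX] : exists X, is_mpinv A X by exact: (xgetPex 0 (ex_intro _ X hX)).
have [r [L [B [-> uL uB]]]] : exists r (L : 'M[R]_(m, r)) (B : 'M[R]_(r, n)),
    [/\ A = L *m B, L^T *m L \in unitmx & B *m B^T \in unitmx].
  exists (\rank A), (col_base A), (row_base A); split.
  - by rewrite mulmx_base.
  - rewrite -[X in _ *m X]trmxK; apply: row_free_gram.
    by rewrite /row_free mxrank_tr; exact: col_base_full.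
  - exact/row_free_gram/row_base_free.
exists (B^T *m invmx (B *m B^T) *m (invmx (L^T *m L) *m L^T)).
set P := B^T *m _; set Q := _ *m L^T.
have BP : B *m P = 1%:M by rewrite /P mulmxA mulmxV.
have QL : Q *m L = 1%:M by rewrite /Q -mulmxA mulVmx.
have AX : L *m B *m (P *m Q) = L *m Q.
  by rewrite -mulmxA (mulmxA B) BP mul1mx.
have XA : P *m Q *m (L *m B) = P *m B.
  by rewrite -mulmxA (mulmxA Q) QL mul1mx.
split.
- by rewrite AX -mulmxA (mulmxA Q) QL mul1mx.
- by rewrite XA -mulmxA (mulmxA B) BP mul1mx.
- by rewrite AX /Q !trmx_mul trmxK trmx_inv trmx_mul trmxK mulmxA.
- by rewrite XA /P !trmx_mul trmxK trmx_inv trmx_mul trmxK mulmxA.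
Qed.

End MatrixOperations.

Section Derivatives.
Variables (R : realType) (n : nat).
Implicit Types (f : 'cV[R]_n -> R) (D : set 'cV[R]_n).

(* C^m on an open set D: f is C^(m+1) when it is Frechet differentiable at    *)
(* every point of D and x |-> df(x) is C^m; since R^n is finite dimensional,  *)
(* the latter means that x |-> df(x)(v) = 'D_v f x is C^m for every v.        *)
Fixpoint Cn (m : nat) D f : Prop :=
  if m is m'.+1 then
    (forall x, D x -> differentiable f x) /\ (forall v, Cn m' D ('D_v f))
  else forall x, D x -> {for x, continuous f}.

Definition hessian f (x : 'cV[R]_n) : 'M[R]_n :=
  \matrix_(i, j) 'D_(delta_mx j 0) ('D_(delta_mx i 0) f) x.

Definition D3 f (x u v w : 'cV[R]_n) : R := 'D_w ('D_v ('D_u f)) x.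

Definition D3_lipschitz f (A : set 'cV[R]_n) (L : R) : Prop :=
  forall x y, A x -> A y ->
    trinorm (fun u v w => D3 f x u v w - D3 f y u v w) <= L * enorm (x - y).

End Derivatives.

Section CSHD.
Variables (R : realType) (n k : nat).
Implicit Types (f : 'cV[R]_n -> R) (S : 'M[R]_(n, k)).

(* The columns of S are the directions s^i. All norms being nonnegative, the  *)
(* base value 0 only matters for k = 0.                                       *)
Definition mx_radius S : R := \big[Num.max/0]_(i < k) enorm (col i S).

Definition eps_f f (x0 : 'cV[R]_n) S : 'cV[R]_k :=
  \col_i (f (x0 + col i S) + f (x0 - col i S) - 2 * f x0).

Definition CSHD f (x0 : 'cV[R]_n) S : 'cV[R]_n :=
  mpinv (hadamard S S)^T *m eps_f f x0 S.

End CSHD.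

(* Main.v *)
(* Full row rank of [W] makes [(W^T)^+] a left inverse of [W^T], so the error  *)
(* is [(W^T)^+] applied to [eps - W^T diag H].  Since [H] is symmetric, entry  *)
(* [i] of [W^T diag H] is [s^T H s - 2 s^T U[H] s] with [s = s^i], and the     *)
(* central difference [f (x0 + s) + f (x0 - s) - 2 f x0 - s^T H s] is at most  *)
(* [L |s|^4 / 12]: along [t |-> x0 +- t s] its third derivative is             *)
(* [D^3 f (x0 + t s) s s s - D^3 f (x0 - t s) s s s], bounded by               *)
(* [2 L t |s|^4], which is integrated three times.  The l1 norm then dominates *)
(* the l2 norm of the residual vector.                                         *)
Require Import Defs.
From HB Require Import structures.
From mathcomp Require Import all_boot all_order all_algebra.
From mathcomp Require Import all_classical all_reals all_analysis.
From mathcomp Require Import ring.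
Set Implicit Arguments.
Unset Strict Implicit.
Unset Printing Implicit Defensive.
Import Order.TTheory GRing.Theory Num.Theory.
Import numFieldNormedType.Exports.
Local Open Scope classical_set_scope.
Local Open Scope ring_scope.

(** The pseudoinverse problem is exactly solvable up to a residual: [mpinv W^T] undoes [W^T]
    ([mpinv_mulmx]), so the error is the pseudoinverse applied to [r = eps - W^T diag H], and
    rescaling by [Delta] ([mpinvZ]) puts [opnorm (mpinv Wt^T)] in front of [Delta ^- 2 *: r].

    Each entry of [r] has two sources. One is the fourth-order remainder of the symmetric second
    difference along [s^i] ([central_difference_quad_le]): the odd Taylor terms cancel, and the
    Lipschitz bound on the third derivative controls the rest. The other is the off-diagonal part of
    the quadratic form, which the diagonal model cannot see ([quad_supper]); symmetry of the Hessian
    ([hessian_sym], by Schwarz's argument) makes it twice the strictly upper part. Bounding the l2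
    norm of the residual by its l1 norm produces the factor [k] and the sum over [i].

    The trilinear norm is a supremum, so it bounds anything only once the third derivative is known
    to be trilinear; [D3_expand] supplies this. *)

(** * Integrating derivative bounds on the unit interval *)

Section OneVariable.
Variable R : realType.
Implicit Types (h dh : R -> R) (C t : R).

Lemma is_derive_within_continuous h dh (a b : R) :
  (forall t, t \in `[a, b] -> is_derive t 1 h (dh t)) ->
  {within `[a, b], continuous h}.
Proof.
move=> hd; apply: derivable_within_continuous => t tab.
by have [] := hd t tab.
Qed.

Lemma MVT_closed h dh (a b : R) : a <= b ->
  (forall t, t \in `[a, b] -> is_derive t 1 h (dh t)) ->
  exists2 c, c \in `[a, b] & h b - h a = dh c * (b - a).
Proof.
move=> ab hd.
have hd' t : t \in `]a, b[ -> is_derive t 1 h (dh t).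
  by move/subset_itv_oo_cc; exact: hd.
exact (MVT_segment ab hd' (is_derive_within_continuous hd)).
Qed.

Lemma is_derive_cpow (c : R) (m : nat) (t : R) :
  is_derive t 1 (fun s => c * s ^+ m) (c * (m%:R * t ^+ m.-1)).
Proof.
have := is_deriveZ c (is_deriveX m (is_derive_id t (1 : R))).
have -> : c \*: (id ^+ m) = (fun s => c * s ^+ m).
  by apply/funext => s; rewrite !fctE.
by rewrite /GRing.scale /= mulr1.
Qed.

(** Subtracting the primitive of [C * t ^+ m] leaves a function with nonpositive derivative; the
    mean value theorem then takes the place of integrating [dh]. *)
Lemma le_power_of_derive h dh C (m : nat) :
  (forall t, t \in `[0, 1] -> is_derive t 1 h (dh t)) -> h 0 = 0 ->
  (forall t, t \in `[0, 1] -> dh t <= C * t ^+ m) ->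
  forall t, t \in `[0, 1] -> h t <= C / m.+1%:R * t ^+ m.+1.
Proof.
move=> hd h0 le_dh t; rewrite in_itv /= => /andP[t0 t1].
have sub s : s \in `[0, t] -> s \in `[0, 1].
  by rewrite !in_itv /= => /andP[-> /= /le_trans]; exact.
pose g s := h s - C / m.+1%:R * s ^+ m.+1.
have gd s : s \in `[0, t] -> is_derive s 1 g (dh s - C * s ^+ m).
  move=> /sub /hd hs.
  have := is_deriveB hs (is_derive_cpow (C / m.+1%:R) m.+1 s).
  by rewrite mulrA divfK // pnatr_eq0.
have [c ct E] := MVT_closed t0 gd.
have : g t - g 0 <= 0.
  rewrite E subr0; apply: mulr_le0_ge0 => //.
  by rewrite subr_le0; apply/le_dh/sub.
by rewrite /g h0 expr0n /= mulr0 !subr0 subr_le0.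
Qed.

Lemma norm_le_power_of_derive h dh C (m : nat) :
  (forall t, t \in `[0, 1] -> is_derive t 1 h (dh t)) -> h 0 = 0 ->
  (forall t, t \in `[0, 1] -> `|dh t| <= C * t ^+ m) ->
  forall t, t \in `[0, 1] -> `|h t| <= C / m.+1%:R * t ^+ m.+1.
Proof.
move=> hd h0 le_dh t t01; rewrite ler_norml lerNl; apply/andP; split.
- apply: (@le_power_of_derive (fun s => - h s) (fun s => - dh s)) => //.
  + by move=> s /hd; apply: is_deriveN.
  + by rewrite h0 oppr0.
  + by move=> s /le_dh; rewrite ler_norml lerNl => /andP[].
- apply: (@le_power_of_derive h dh) => // s /le_dh.
  by rewrite ler_norml => /andP[].
Qed.

End OneVariable.


(** * Directional derivatives along lines and symmetry of mixed derivatives *)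

Section Directional.
Variables (R : realType) (V : normedModType R).
Implicit Types (f : V -> R) (x v w : V).

Lemma is_derive_line f x v (t : R) : derivable f (x + t *: v) v ->
  is_derive t 1 (fun s => f (x + s *: v)) ('D_v f (x + t *: v)).
Proof.
move=> fd.
have E : (fun h : R => h^-1 *: (((fun s => f (x + s *: v)) \o shift t) (h *: 1)
            - f (x + t *: v))) =
    (fun h => h^-1 *: ((f \o shift (x + t *: v)) (h *: v) - f (x + t *: v))).
  by apply/funext => h /=; rewrite scaler1 scalerDl addrCA.
by split; rewrite /derivable /derive E.
Qed.

Lemma is_derive_lineN f x v (t : R) : derivable f (x - t *: v) v ->
  is_derive t 1 (fun s => f (x - s *: v)) (- 'D_v f (x - t *: v)).
Proof.
move=> fd.
have fd' : is_derive (- t) 1 (fun s => f (x + s *: v)) ('D_v f (x - t *: v)).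
  by rewrite -scaleNr; apply: is_derive_line; rewrite scaleNr.
have := is_derive1_comp fd' (is_deriveN (is_derive_id t 1)).
have -> : (fun s => f (x + s *: v)) \o - id = (fun s => f (x - s *: v)).
  by apply/funext => s /=; rewrite scaleNr.
by rewrite mulrN1.
Qed.

Lemma dist_le_of_halves (e p q r s : R) :
  s = r -> `|p - r| < e / 2 -> `|q - s| < e / 2 -> `|p - q| <= e.
Proof.
move=> -> pr qr; rewrite -(subrKA r) (le_trans (ler_normD _ _)) // ltW //.
by rewrite [e in _ < e]splitr ltrD // distrC.
Qed.

(* The mean value theorem is applied along [u], then along [v]. *)
Lemma double_difference f x u v (h : R) : 0 < h ->
  (forall a b, a \in `[0, h] -> b \in `[0, h] ->
    derivable f (x + a *: u + b *: v) u /\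
    derivable ('D_u f) (x + a *: u + b *: v) v) ->
  exists a b, [/\ a \in `[0, h], b \in `[0, h] &
    f (x + h *: u + h *: v) - f (x + h *: u) - f (x + h *: v) + f x =
    h ^+ 2 * 'D_v ('D_u f) (x + a *: u + b *: v)].
Proof.
move=> h0 fd.
have h0h : 0 \in `[0, h] by rewrite in_itv /= lexx ltW.
have hh : h \in `[0, h] by rewrite in_itv /= lexx ltW.
pose g a := f (x + h *: v + a *: u) - f (x + a *: u).
pose dg a := 'D_u f (x + h *: v + a *: u) - 'D_u f (x + a *: u).
have gd a : a \in `[0, h] -> is_derive a 1 g (dg a).
  move=> ah; apply: is_deriveB; apply: is_derive_line.
    have [fu _] := fd a h ah hh.
    by rewrite -addrA (addrC (h *: v)) addrA; exact: fu.
  by have [+ _] := fd a 0 ah h0h; rewrite scale0r addr0.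
have [a ah Ea] := MVT_closed (ltW h0) gd.
pose k b := 'D_u f (x + a *: u + b *: v).
have kd b : b \in `[0, h] ->
    is_derive b 1 k ('D_v ('D_u f) (x + a *: u + b *: v)).
  by move=> bh; apply: is_derive_line; have [] := fd a b ah bh.
have [b bh Eb] := MVT_closed (ltW h0) kd.
exists a, b; split => //.
have -> : f (x + h *: u + h *: v) - f (x + h *: u) - f (x + h *: v) + f x =
    g h - g 0.
  by rewrite /g !scale0r !addr0 (addrAC x); ring.
rewrite Ea /dg; move: Eb; rewrite /k scale0r addr0 (addrAC x (a *: u)) => ->.
by ring.
Qed.

(** The second difference over the parallelogram spanned by [h *: u] and [h *: v] is symmetric in
    [u] and [v], and [double_difference] equates it with [h ^+ 2] times either mixed derivative at
    some nearby point. Continuity at [x] carries the equality over to [x]. *)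
Lemma schwarz_derive_comm f x u v :
  (\forall y \near x, [/\ derivable f y u, derivable f y v,
     derivable ('D_u f) y v & derivable ('D_v f) y u]) ->
  {for x, continuous ('D_v ('D_u f))} -> {for x, continuous ('D_u ('D_v f))} ->
  'D_v ('D_u f) x = 'D_u ('D_v f) x.
Proof.
move=> fd cvu cuv; apply/eqP; rewrite -subr_eq0 -normr_le0.
apply/ler_addgt0Pr => e e0; rewrite add0r.
have e2 : 0 < e / 2 by rewrite divr_gt0.
have near_vu : \forall y \near x, `|'D_v ('D_u f) x - 'D_v ('D_u f) y| < e / 2.
  by move/cvgrPdist_lt : cvu; apply.
have near_uv : \forall y \near x, `|'D_u ('D_v f) x - 'D_u ('D_v f) y| < e / 2.
  by move/cvgrPdist_lt : cuv; apply.
have [d /= d0 near_x] := (nbhs_normP _ _).1 (filterI fd (filterI near_vu near_uv)).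
(* This side length keeps the whole parallelogram within [d / 2] of [x]; the [+ 1] covers the case
   where [u] and [v] are both zero. *)
pose h := d / (`|u| + `|v| + 1) / 2.
have den : 0 < `|u| + `|v| + 1 by rewrite ltr_wpDl // addr_ge0.
have h0 : 0 < h by rewrite !divr_gt0.
have box a b : a \in `[0, h] -> b \in `[0, h] ->
    ball_ Num.norm x d (x + a *: u + b *: v).
  rewrite !in_itv /= => /andP[a0 ah] /andP[b0 bh].
  rewrite -addrA opprD addrA subrr add0r normrN.
  apply: (le_lt_trans (ler_normD _ _)); rewrite !normrZ !ger0_norm //.
  apply: (@le_lt_trans _ _ (h * (`|u| + `|v| + 1))).
    rewrite !mulrDr mulr1 -[leLHS]addr0.
    by rewrite !lerD ?ler_wpM2r // ltW.
  by rewrite /h mulrAC divfK ?gt_eqF // ltr_pdivrMr // ltr_pMr // ltr1n.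
have box' a b : a \in `[0, h] -> b \in `[0, h] ->
    ball_ Num.norm x d (x + a *: v + b *: u).
  by move=> ah bh; rewrite -addrA (addrC (a *: v)) addrA; apply: box.
have duv a b : a \in `[0, h] -> b \in `[0, h] ->
    derivable f (x + a *: u + b *: v) u /\
    derivable ('D_u f) (x + a *: u + b *: v) v.
  move=> ah bh; have [[fu _ fuv _] _] := near_x _ (box a b ah bh).
  by split; [exact: fu|exact: fuv].
have dvu a b : a \in `[0, h] -> b \in `[0, h] ->
    derivable f (x + a *: v + b *: u) v /\
    derivable ('D_v f) (x + a *: v + b *: u) u.
  move=> ah bh; have [[_ fv _ fvu] _] := near_x _ (box' a b ah bh).
  by split; [exact: fv|exact: fvu].
have [a [b [ah bh Eab]]] := double_difference h0 duv.
have [a' [b' [ah' bh' Eab']]] := double_difference h0 dvu.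
have E : 'D_u ('D_v f) (x + a' *: v + b' *: u) =
    'D_v ('D_u f) (x + a *: u + b *: v).
  apply: (@mulfI _ (h ^+ 2)); first by rewrite expf_neq0 ?gt_eqF.
  apply: etrans (esym Eab') _; apply: etrans _ Eab.
  have swap : x + h *: v + h *: u = x + h *: u + h *: v by exact: addrAC.
  by rewrite swap; congr (_ + _); exact: addrAC.
have [_ [lt1 _]] := near_x _ (box a b ah bh).
have [_ [_ lt2]] := near_x _ (box' a' b' ah' bh').
exact: dist_le_of_halves E lt1 lt2.
Qed.

End Directional.

(** * Euclidean, operator and trilinear norms *)

Section EuclideanNorm.
Variable R : realType.

Lemma enorm_ge0 n (x : 'cV[R]_n) : 0 <= enorm x.
Proof. exact: sqrtr_ge0. Qed.

Lemma enormZ n (a : R) (x : 'cV[R]_n) : enorm (a *: x) = `|a| * enorm x.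
Proof.
rewrite /enorm; under eq_bigr => i _ do rewrite mxE exprMn.
by rewrite -mulr_sumr sqrtrM ?sqr_ge0 // sqrtr_sqr.
Qed.

Lemma ler_abs_enorm n (x : 'cV[R]_n) i : `|x i 0| <= enorm x.
Proof.
rewrite -sqrtr_sqr; apply: ler_wsqrtr; rewrite (bigD1 i) //= lerDl.
by apply: sumr_ge0 => j _; exact: sqr_ge0.
Qed.

Lemma enorm_eq0 n (x : 'cV[R]_n) : enorm x = 0 -> x = 0.
Proof.
move=> x0; apply/colP => i; rewrite mxE; apply/eqP.
by rewrite -normr_le0 -[leRHS]x0 ler_abs_enorm.
Qed.

Lemma enorm_le_sum n (x : 'cV[R]_n) : enorm x <= \sum_i `|x i 0|.
Proof.
have s0 (P : pred 'I_n) : 0 <= \sum_(i | P i) `|x i 0| by exact: sumr_ge0.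
rewrite -[leRHS]ger0_norm // -sqrtr_sqr ler_sqrt ?sqr_ge0 //.
rewrite expr2 mulr_suml; apply: ler_sum => i _.
by rewrite -real_normK ?num_real // expr2 ler_wpM2l // (bigD1 i) //= lerDl.
Qed.

Lemma opnorm_ub m n (A : 'M[R]_(m, n)) (x : 'cV[R]_n) :
  enorm x <= 1 -> enorm (A *m x) <= opnorm A.
Proof.
move=> x1; apply: ub_le_sup; last by exists x.
(* A finite upper bound is needed for the supremum to be genuine; coordinates of a unit-ball vector
   are at most 1 in absolute value. *)
exists (\sum_i \sum_j `|A i j|) => _ [z /= z1 <-].
apply: (le_trans (enorm_le_sum _)); apply: ler_sum => i _.
rewrite mxE; apply: (le_trans (ler_norm_sum _ _ _)); apply: ler_sum => j _.
by rewrite normrM ler_piMr // (le_trans (ler_abs_enorm _ _)).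
Qed.

Lemma opnorm_ge0 m n (A : 'M[R]_(m, n)) : 0 <= opnorm A.
Proof.
apply: (le_trans (enorm_ge0 (A *m 0))); apply: opnorm_ub.
by rewrite -(scale0r 0) enormZ normr0 mul0r.
Qed.

Lemma enorm_mul_le m n (A : 'M[R]_(m, n)) (x : 'cV[R]_n) :
  enorm (A *m x) <= opnorm A * enorm x.
Proof.
have [x0|x_neq0] := eqVneq (enorm x) 0.
  by rewrite x0 (enorm_eq0 x0) mulmx0 -(scale0r 0) enormZ normr0 mul0r mulr0.
have x_gt0 : 0 < enorm x by rewrite lt_def x_neq0 enorm_ge0.
rewrite -ler_pdivrMr // -[enorm x in leLHS]ger0_norm ?enorm_ge0 //.
rewrite mulrC -normfV -enormZ scalemxAr; apply: opnorm_ub.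
by rewrite enormZ normfV ger0_norm ?enorm_ge0 // mulVf.
Qed.

(* [c] witnesses that [T] is trilinear, so the supremum [trinorm T] is finite. *)
Lemma trilinear_diag_le n (T : 'cV[R]_n -> 'cV[R]_n -> 'cV[R]_n -> R)
    (c : 'I_n -> 'I_n -> 'I_n -> R) (s : 'cV[R]_n) :
  (forall u v w, T u v w =
     \sum_i \sum_j \sum_l u i 0 * (v j 0 * (w l 0 * c i j l))) ->
  `|T s s s| <= trinorm T * enorm s ^+ 3.
Proof.
move=> TE.
have bound t : enorm t <= 1 -> `|T t t t| <= trinorm T.
  move=> t1; apply: ub_le_sup; last by exists t, t, t.
  exists (\sum_i \sum_j \sum_l `|c i j l|) => _ [u [v [w [u1 v1 w1 ->]]]].
  rewrite TE.
  do 3!(apply: (le_trans (ler_norm_sum _ _ _)); apply: ler_sum => ? _).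
  rewrite !normrM; do 3!(apply: le_trans (ler_piMl _ _) _;
    [by rewrite ?mulr_ge0|exact: (le_trans (ler_abs_enorm _ _))|]).
  exact: lexx.
have TZ a t : T (a *: t) (a *: t) (a *: t) = a ^+ 3 * T t t t.
  rewrite !TE !mulr_sumr; apply: eq_bigr => i _.
  rewrite !mulr_sumr; apply: eq_bigr => j _.
  rewrite !mulr_sumr; apply: eq_bigr => l _.
  by rewrite !mxE; ring.
have [s0|s_neq0] := eqVneq (enorm s) 0.
  rewrite s0 (enorm_eq0 s0) -(scale0r 0) TZ.
  by rewrite expr0n /= mul0r normr0 mulr0.
(* Normalising [s] reduces to the unit ball, cubic homogeneity [TZ] restoring the factor
   [enorm s ^+ 3]. *)
have -> : s = enorm s *: ((enorm s)^-1 *: s) by rewrite scalerA mulfV ?scale1r.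
set e := enorm s in s_neq0 *; set t := e^-1 *: s.
have e0 : 0 <= e by exact: enorm_ge0.
have t1 : enorm t = 1 by rewrite enormZ normfV ger0_norm // mulVf.
rewrite TZ enormZ t1 mulr1 normrM normrX ger0_norm // mulrC.
by rewrite ler_wpM2r ?exprn_ge0 // bound // t1.
Qed.

End EuclideanNorm.

(** * Left inverse and scaling properties of the pseudoinverse *)

Section Pseudoinverse.
Variable R : realType.

(** Full column rank of [A] allows cancelling [A] on the left in the Penrose identity
    [A X A = A]. *)
Lemma mpinv_mulmx m n (A : 'M[R]_(m, n)) : row_free A^T -> mpinv A *m A = 1%:M.
Proof.
move=> fA; have [AXA _ _ _] := mpinvP A.
apply/trmx_inj/(row_free_inj fA).
by rewrite -trmx_mul mulmxA AXA trmx1 mul1mx.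
Qed.

Lemma mpinvZ m n (a : R) (A : 'M[R]_(m, n)) : a != 0 ->
  mpinv (a *: A) = a^-1 *: mpinv A.
Proof.
move=> a0; apply: (is_mpinv_uniq (mpinvP _)).
have [X1 X2 X3 X4] := mpinvP A.
have AX : a *: A *m (a^-1 *: mpinv A) = A *m mpinv A.
  by rewrite -scalemxAl -scalemxAr scalerA mulfV // scale1r.
have XA : a^-1 *: mpinv A *m (a *: A) = mpinv A *m A.
  by rewrite -scalemxAl -scalemxAr scalerA mulVf // scale1r.
by split; rewrite ?AX ?XA // -scalemxAr ?X1 ?X2.
Qed.

End Pseudoinverse.

(** * Multilinearity of derivatives and the central difference estimate *)

Section SmoothFunctions.
Variables (R : realType) (n : nat).
Implicit Types (f g : 'cV[R]_n -> R) (D : set 'cV[R]_n) (x u v w s : 'cV[R]_n).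

Local Notation e_ i := (delta_mx i 0 : 'cV[R]_n).

Lemma Cn_continuous m D f x : Cn m D f -> D x -> {for x, continuous f}.
Proof.
by case: m => [|m] => [fc /fc //|[fd _] /fd]; exact: differentiable_continuous.
Qed.

Lemma Cn_weaken m D f : Cn m.+1 D f -> Cn m D f.
Proof.
elim: m f => [|m IH] f [fd fC].
  by move=> x /fd; exact: differentiable_continuous.
by split=> // v; exact: IH.
Qed.

Lemma Cn_derivable m D f x v : Cn m.+1 D f -> D x -> derivable f x v.
Proof. by move=> [fd _] /fd; exact: diff_derivable. Qed.

Lemma Cn_derive m D f v : Cn m.+1 D f -> Cn m D ('D_v f).
Proof. by move=> [_ fC]; exact: fC. Qed.

Lemma derive_expand m D f x v : Cn m.+1 D f -> D x ->
  'D_v f x = \sum_i v i 0 * 'D_(e_ i) f x.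
Proof.
move=> [fd _] /fd fdx; rewrite deriveE //.
have {1}-> : v = \sum_i v i 0 *: e_ i.
  by rewrite [LHS]matrix_sum_delta; apply: eq_bigr => i _; rewrite big_ord1.
by rewrite linear_sum; apply: eq_bigr => i _; rewrite linearZ /= -deriveE.
Qed.

Lemma derive_near_sum D g (gs : 'I_n -> 'cV[R]_n -> R) (c : 'I_n -> R) x w :
  open D -> D x ->
  (forall y, D y -> g y = \sum_i c i * gs i y) ->
  (forall i, derivable (gs i) x w) ->
  'D_w g x = \sum_i c i * 'D_w (gs i) x.
Proof.
move=> oD Dx gE gd.
(* The identity is known only on [D]; openness makes it hold near [x], which is all a derivative
   sees. *)
have near_E : \near x, g x = (\sum_i (c i \*: gs i)) x.
  by near=> y; rewrite fct_sumE; apply: gE; near: y; exact: open_nbhs_nbhs.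
rewrite (near_eq_derive _ near_E) derive_sum; last first.
  by move=> i; apply/derivableZ/gd.
by apply: eq_bigr => i _; rewrite deriveZ //; exact: gd.
Unshelve. all: by end_near.
Qed.

Lemma derive2_expand m D f x v w : open D -> Cn m.+2 D f -> D x ->
  'D_w ('D_v f) x = \sum_i v i 0 * 'D_w ('D_(e_ i) f) x.
Proof.
move=> oD fC Dx; apply: (derive_near_sum oD Dx).
- by move=> y; exact: derive_expand fC.
- by move=> i; exact: Cn_derivable (Cn_derive _ fC) Dx.
Qed.

Lemma D3_expand D f x u v w : open D -> Cn 3 D f -> D x ->
  D3 f x u v w = \sum_i \sum_j \sum_l
    u i 0 * (v j 0 * (w l 0 * D3 f x (e_ i) (e_ j) (e_ l))).
Proof.
move=> oD fC Dx; rewrite {1}/D3.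
have gE y : D y -> 'D_v ('D_u f) y = \sum_i u i 0 * 'D_v ('D_(e_ i) f) y.
  exact: derive2_expand fC.
have gd i : derivable ('D_v ('D_(e_ i) f)) x w.
  exact: Cn_derivable (Cn_derive _ (Cn_derive _ fC)) Dx.
apply: etrans (derive_near_sum oD Dx gE gd) _; apply: eq_bigr => i _.
rewrite (derive2_expand _ _ oD (Cn_derive _ fC) Dx) mulr_sumr.
apply: eq_bigr => j _.
rewrite (derive_expand _ (Cn_derive _ (Cn_derive _ fC)) Dx) !mulr_sumr.
by apply: eq_bigr.
Qed.

Lemma D3_diff_le D f x y s : open D -> Cn 3 D f -> D x -> D y ->
  `|D3 f x s s s - D3 f y s s s| <=
  trinorm (fun u v w => D3 f x u v w - D3 f y u v w) * enorm s ^+ 3.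
Proof.
move=> oD fC Dx Dy.
pose c i j l := D3 f x (e_ i) (e_ j) (e_ l) - D3 f y (e_ i) (e_ j) (e_ l).
apply: (@trilinear_diag_le _ _ (fun u v w => D3 f x u v w - D3 f y u v w) c).
move=> u v w; rewrite (D3_expand _ _ _ oD fC Dx) (D3_expand _ _ _ oD fC Dy).
do 3!(rewrite -sumrB; apply: eq_bigr => ? _).
by rewrite /c !mulrBr.
Qed.

Lemma hessian_quad m D f x s : open D -> Cn m.+2 D f -> D x ->
  'D_s ('D_s f) x = (s^T *m hessian f x *m s) 0 0.
Proof.
move=> oD fC Dx; rewrite (derive2_expand _ _ oD fC Dx) -mulmxA mxE.
apply: eq_bigr => i _; rewrite !mxE; congr (_ * _).
rewrite (derive_expand _ (Cn_derive _ fC) Dx).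
by apply: eq_bigr => j _; rewrite mxE mulrC.
Qed.

Lemma hessian_sym m D f x : open D -> Cn m.+2 D f -> D x ->
  (hessian f x)^T = hessian f x.
Proof.
move=> oD fC Dx; apply/matrixP => i j; rewrite !mxE; apply: schwarz_derive_comm.
- have : \forall y \near x, D y by exact: open_nbhs_nbhs.
  apply: filterS => y Dy; split.
  + exact: Cn_derivable fC Dy.
  + exact: Cn_derivable fC Dy.
  + exact: Cn_derivable (Cn_derive _ fC) Dy.
  + exact: Cn_derivable (Cn_derive _ fC) Dy.
- exact: Cn_continuous (Cn_derive _ (Cn_derive _ fC)) Dx.
- exact: Cn_continuous (Cn_derive _ (Cn_derive _ fC)) Dx.
Qed.

(** The even function [f (x + t s) + f (x - t s)] is compared with its quadratic Taylor polynomial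
    at [t = 0]. Integrating the bound [C * t] on the third derivative of the remainder three times
    gives [C / (2 * 3 * 4)]. *)
Lemma central_difference_le D f x s (C : R) : open D -> Cn 3 D f ->
  (forall t : R, t \in `[0, 1] -> D (x + t *: s) /\ D (x - t *: s)) ->
  (forall t : R, t \in `[0, 1] ->
     `|D3 f (x + t *: s) s s s - D3 f (x - t *: s) s s s| <= C * t) ->
  `|f (x + s) + f (x - s) - 2 * f x - 'D_s ('D_s f) x| <= C / 24.
Proof.
move=> oD fC Dxs C_ub.
have dplus g (t : R) : Cn 1 D g -> t \in `[0, 1] -> is_derive t 1
    (fun r => g (x + r *: s)) ('D_s g (x + t *: s)).
  by move=> gC /Dxs[Dp _]; apply: is_derive_line; exact: Cn_derivable gC Dp.
have dminus g (t : R) : Cn 1 D g -> t \in `[0, 1] -> is_derive t 1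
    (fun r => g (x - r *: s)) (- 'D_s g (x - t *: s)).
  by move=> gC /Dxs[_ Dm]; apply: is_derive_lineN; exact: Cn_derivable gC Dm.
pose q := 'D_s ('D_s f) x.
(* [h0] is the remainder and [h1], [h2], [h3] its successive derivatives; subtracting [q * t ^+ 2]
   makes [h2] vanish at 0. The exponent 1 in [h1] matches [is_derive_cpow]. *)
pose h0 (t : R) := f (x + t *: s) + f (x - t *: s) - 2 * f x - q * t ^+ 2.
pose h1 (t : R) := 'D_s f (x + t *: s) - 'D_s f (x - t *: s) - 2 * q * t ^+ 1.
pose h2 (t : R) := 'D_s ('D_s f) (x + t *: s) + 'D_s ('D_s f) (x - t *: s) - 2 * q.
pose h3 (t : R) := D3 f (x + t *: s) s s s - D3 f (x - t *: s) s s s.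
have f1 : Cn 2 D ('D_s f) by exact: Cn_derive fC.
have f2 : Cn 1 D ('D_s ('D_s f)) by exact: Cn_derive f1.
have f0 : Cn 1 D f by exact/Cn_weaken/Cn_weaken.
have d2 (t : R) : t \in `[0, 1] -> is_derive t 1 h2 (h3 t).
  move=> t01; have := is_deriveB (is_deriveD (dplus _ _ f2 t01)
    (dminus _ _ f2 t01)) (is_derive_cst (2 * q) t 1).
  by rewrite subr0.
have d1 (t : R) : t \in `[0, 1] -> is_derive t 1 h1 (h2 t).
  move=> t01; have := is_deriveB (is_deriveB (dplus _ _ (Cn_weaken f1) t01)
    (dminus _ _ (Cn_weaken f1) t01)) (is_derive_cpow (2 * q) 1 t).
  by rewrite opprK expr0 !mulr1.
have d0 (t : R) : t \in `[0, 1] -> is_derive t 1 h0 (h1 t).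
  move=> t01; have := is_deriveB (is_deriveB (is_deriveD (dplus _ _ f0 t01)
    (dminus _ _ f0 t01)) (is_derive_cst (2 * f x) t 1)) (is_derive_cpow q 2 t).
  by rewrite subr0 mulrA (mulrC q).
have h20 : h2 0 = 0 by rewrite /h2 scale0r addr0 subr0 /q; ring.
have h10 : h1 0 = 0 by rewrite /h1 scale0r addr0 subr0; ring.
have h00 : h0 0 = 0 by rewrite /h0 scale0r addr0 subr0; ring.
have b2 := norm_le_power_of_derive d2 h20 (m := 1) C_ub.
have b1 := norm_le_power_of_derive d1 h10 b2.
have b0 := norm_le_power_of_derive d0 h00 b1.
have one01 : (1 : R) \in `[0, 1] by rewrite in_itv /= lexx ler01.
have := b0 1 one01; rewrite /h0 !expr1n !mulr1 !scale1r.
suff -> : C / 2%:R / 3%:R / 4%:R = C / 24 by [].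
by field.
Qed.

Lemma central_difference_quad_le D f x s (L r : R) :
  open D -> eball x r `<=` D -> Cn 3 D f -> 0 <= L ->
  D3_lipschitz f (eball x r) L -> enorm s <= r ->
  `|f (x + s) + f (x - s) - 2 * f x - (s^T *m hessian f x *m s) 0 0|
    <= L / 12 * r ^+ 4.
Proof.
move=> oD bD fC L0 lip sr.
have ball_s (t : R) : `|t| <= 1 -> eball x r (x + t *: s).
  move=> t1; rewrite /eball /= addrAC subrr add0r enormZ.
  by rewrite (le_trans _ sr) // ler_piMl // enorm_ge0.
have norm01 (t : R) : t \in `[0, 1] -> `|t| <= 1 /\ `|- t| <= 1.
  by rewrite in_itv /= normrN => /andP[t0 t1]; rewrite ger0_norm.
have Dx : D x.
  apply: bD; have := ball_s 0.
  by rewrite normr0 scale0r addr0; apply; exact: ler01.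
rewrite -(hessian_quad _ oD fC Dx).
(* Here [C = 2 * L * enorm s ^+ 4]: the points [x + t s] and [x - t s] are [2 t |s|] apart, and
   evaluating the trilinear form at [s] three times contributes [|s|^3]. *)
apply: (@le_trans _ _ (2 * L * enorm s ^+ 4 / 24)); last first.
  apply: (@le_trans _ _ (L / 12 * enorm s ^+ 4)).
    by rewrite le_eqVlt; apply/orP; left; apply/eqP; field.
  by rewrite ler_wpM2l ?divr_ge0 // lerXn2r ?nnegrE ?(le_trans _ sr) ?enorm_ge0.
apply: (central_difference_le oD fC) => t t01; have [t1 t1'] := norm01 t t01.
  by rewrite -scaleNr; split; apply/bD/ball_s.
have t0 : 0 <= t by move: t01; rewrite in_itv /= => /andP[].
have bp := ball_s _ t1; have bm := ball_s _ t1'.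
rewrite scaleNr in bm.
apply: (le_trans (D3_diff_le _ oD fC (bD _ bp) (bD _ bm))).
apply: (@le_trans _ _ (L * enorm (2 * t *: s) * enorm s ^+ 3)); last first.
  rewrite enormZ ger0_norm ?mulr_ge0 //.
  by rewrite le_eqVlt; apply/orP; left; apply/eqP; ring.
rewrite ler_wpM2r ?exprn_ge0 ?enorm_ge0 //.
have -> : 2 * t *: s = x + t *: s - (x - t *: s).
  by rewrite opprB addrC subrKA -scalerDl; congr (_ *: _); ring.
exact: lip.
Qed.

End SmoothFunctions.

(** * Diagonal and off-diagonal parts of the Hessian, and the final estimate *)

Lemma quad_supper (R : realType) n (H : 'M[R]_n) (s : 'cV[R]_n) : H^T = H ->
  (s^T *m H *m s) 0 0 =
  ((hadamard s s)^T *m diagv H) 0 0 + 2 * (s^T *m supper H *m s) 0 0.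
Proof.
move=> HT.
(* A symmetric matrix is its diagonal plus [supper H] and its transpose; the last two have the same
   quadratic form, whence the factor 2. *)
have HE : H = diag_mx (diagv H)^T + (supper H + (supper H)^T).
  apply/matrixP => i j; rewrite !mxE; case: ltngtP => [||/val_inj->].
  - by move=> ij; rewrite -val_eqE /= ltn_eqF // mulr0n add0r addr0.
  - move=> ji; rewrite -val_eqE /= gtn_eqF // mulr0n !add0r.
    by rewrite -[in LHS]HT mxE.
  - by rewrite eqxx mulr1n !addr0.
have addE (A B : 'M[R]_1) : (A + B) 0 0 = A 0 0 + B 0 0 by rewrite mxE.
rewrite [in LHS]HE !(mulmxDr, mulmxDl) !addE.
congr (_ + _).
  rewrite -mulmxA !mxE; apply: eq_bigr => i _.
  by rewrite mul_diag_mx !mxE; ring.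
have -> : (s^T *m (supper H)^T *m s) 0 0 = (s^T *m supper H *m s) 0 0.
  by rewrite -trmx_mul -[X in _ *m X]trmxK -trmx_mul mxE mulmxA.
by rewrite mulr2n mulrDl mul1r.
Qed.

Lemma enorm_col_le_radius (R : realType) n k (S : 'M[R]_(n, k)) i :
  enorm (col i S) <= mx_radius S.
Proof. exact: (le_bigmax_cond 0 (fun i => enorm (col i S))). Qed.

Theorem theorem3p2 (R : realType) (n k : nat) (D : set 'cV[R]_n)
    (f : 'cV[R]_n -> R) (x0 : 'cV[R]_n) (S : 'M[R]_(n, k)) (L : R) :
  let Delta : R := mx_radius S in
  let W : 'M[R]_(n, k) := hadamard S S in
  let Wt : 'M[R]_(n, k) := Delta ^- 2 *: W in
  let shat : 'I_k -> 'cV[R]_n := fun i => Delta^-1 *: col i S in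
  0 < Delta ->
  open D ->
  eball x0 Delta `<=` D ->
  Cn 4 D f ->
  0 <= L ->
  D3_lipschitz f (eball x0 Delta) L ->
  row_free W ->
  enorm (CSHD f x0 S - diagv (hessian f x0))
    <= opnorm (mpinv Wt^T)
       * (k%:R / 12 * L * Delta ^+ 2
          + 2 * \sum_(i < k)
                  `|((shat i)^T *m supper (hessian f x0) *m shat i) 0 0|).
Proof.
move=> Delta W Wt shat Delta0 oD bD fC L0 lip fW.
set H := hessian f x0.
have fC3 : Cn 3 D f by exact: Cn_weaken.
have Dx0 : D x0.
  by apply: bD; rewrite /eball /= subrr -(scale0r 0) enormZ normr0 mul0r ltW.
have H_sym : H^T = H by exact: hessian_sym oD fC Dx0.
have D2_neq0 : Delta ^- 2 != 0 by rewrite invr_neq0 // expf_neq0 // gt_eqF.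
pose r := eps_f f x0 S - W^T *m diagv H.
(* Since [Wt = Delta ^- 2 *: W], its transposed pseudoinverse gains [Delta ^+ 2], which the factor
   on [r] compensates. *)
have diffE : CSHD f x0 S - diagv H = mpinv Wt^T *m (Delta ^- 2 *: r).
  have -> : Wt^T = Delta ^- 2 *: W^T by rewrite /Wt linearZ.
  rewrite mpinvZ // -scalemxAl -scalemxAr scalerA mulVf // scale1r.
  by rewrite /r mulmxBr mulmxA mpinv_mulmx ?trmxK // mul1mx.
rewrite diffE; apply: (le_trans (enorm_mul_le _ _)).
apply: ler_wpM2l; first exact: opnorm_ge0.
apply: (le_trans (enorm_le_sum _)).
(* The constant term is spread evenly over the [k] entries so that the bound can be proved entry by
   entry. *)
have -> : k%:R / 12 * L * Delta ^+ 2 = \sum_(i < k) (L / 12 * Delta ^+ 2).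
  by rewrite sumr_const card_ord -mulr_natl; ring.
rewrite mulr_sumr -big_split /=; apply: ler_sum => i _.
set s := col i S.
pose U := (s^T *m supper H *m s) 0 0.
have WE : (W^T *m diagv H) i 0 = ((hadamard s s)^T *m diagv H) 0 0.
  by rewrite !mxE; apply: eq_bigr => j _; rewrite !mxE.
have UE : ((shat i)^T *m supper H *m shat i) 0 0 = Delta ^- 2 * U.
  have -> : (shat i)^T = Delta^-1 *: s^T by rewrite /shat linearZ.
  by rewrite /shat -!scalemxAl -scalemxAr scalerA mxE -invfM -expr2.
(* Splitting [W^T diag H] by [quad_supper] exposes the central difference remainder plus the
   off-diagonal term. *)
have rE : r i 0 =
    f (x0 + s) + f (x0 - s) - 2 * f x0 - (s^T *m H *m s) 0 0 + 2 * U.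
  have := quad_supper s H_sym; rewrite -WE -/U => ->.
  have -> : r i 0 = eps_f f x0 S i 0 - (W^T *m diagv H) i 0.
    by rewrite [LHS]mxE [X in _ + X = _]mxE.
  by rewrite [eps_f _ _ _ _ _]mxE; ring.
have lo := central_difference_quad_le oD bD fC3 L0 lip (enorm_col_le_radius S i).
have D2_ge0 : 0 <= Delta ^- 2 by rewrite invr_ge0 exprn_ge0 // ltW.
rewrite UE mxE rE !normrM (ger0_norm D2_ge0).
(* The factor [Delta ^- 2] turns the remainder's [Delta ^+ 4] into [Delta ^+ 2], and is the one that
   normalises both copies of [s] in [U]. *)
apply: (@le_trans _ _ (Delta ^- 2 * (L / 12 * Delta ^+ 4 + 2 * `|U|))).
  apply: ler_wpM2l => //; apply: (le_trans (ler_normD _ _)).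
  by rewrite normrM normr_nat; apply: lerD.
by rewrite le_eqVlt; apply/orP; left; apply/eqP; field; rewrite gt_eqF.
Qed.
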